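(* Let $d\ge 1$. Suppose $\kappa \leq 2^{\aleph_0}$ is a regular (infinite) cardinal, and $X \subseteq \mathbb{R}^d$ has $|X| = \kappa$. Then there is $Y \subseteq X$ of size $\kappa$, and some $2 \leq a \leq d+1$, such that $Y$ is strictly $a$-rainbow.
   Context: The volume of an $a$-element set of points of $\mathbb{R}^d$ ($a \geq 2$) is the $(a-1)$-dimensional volume of the simplex they span (length for $a=2$, area for $a=3$, and so on); it is $0$ exactly when the points are affinely dependent. A set $X \subseteq \mathbb{R}^d$ is strongly $a$-rainbow if all $a$-element subsets of $X$ yield nonzero volumes, and distinct $a$-element subsets yield distinct volumes. $X$ is strictly $a$-rainbow if $X$ is strongly $a'$-rainbow for all $2 \leq a' \leq a$, and $X$ is a subset of an $(a-1)$-dimensional hyperplane (i.e. an $(a-1)$-dimensional affine subspace of $\mathbb{R}^d$). *)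

(* Defs.v *)
From mathcomp Require Import all_boot all_order all_algebra all_fingroup finmap.
From mathcomp Require Import all_classical wochoice reals.

Set Implicit Arguments.
Unset Strict Implicit.
Unset Printing Implicit Defensive.

Import Order.TTheory GRing.Theory Num.Theory.

Local Open Scope classical_set_scope.
Local Open Scope card_scope.
Local Open Scope ring_scope.

(* A cardinal is given by a type [K], up to equinumerosity. *)

(* [le] orders [K] in the type of an initial ordinal: every initial segment
   [{y | y < x}] is of smaller cardinality than [K]. *)
Definition initial_well_order (K : Type) (le : rel K) : Prop :=
  well_order le /\
  forall x, ~~ ([set: K] #<= [set y | le y x /\ y <> x]).

Definition cofinal (K : Type) (le : rel K) (S : set K) : Prop :=
  forall x, exists2 y, S y & le x y.

(* [K] is infinite and equal to its own cofinality. *)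
Definition regular_cardinal (K : Type) : Prop :=
  infinite_set [set: K] /\
  exists le : rel K, initial_well_order le /\
    forall S : set K, cofinal le S -> [set: K] #<= S.

Section Volume.
Context {R : realType} {d : nat}.
Implicit Types (A B : {fset 'rV[R]_d}) (X : set 'rV[R]_d).

Definition edge_mx k (p : 'I_k.+1 -> 'rV[R]_d) : 'M[R]_(k, d) :=
  \matrix_(i < k) (p (lift ord0 i) - p ord0).

(* k-dimensional Euclidean volume of the simplex with vertices [p 0, ..., p k],
   as 1/k! times the volume of the parallelotope spanned by the edges at [p 0],
   the latter being the square root of their Gram determinant. *)
Definition simplex_volume k (p : 'I_k.+1 -> 'rV[R]_d) : R :=
  Num.sqrt (\det (edge_mx p *m (edge_mx p)^T)) / k`!%:R.

(* The vertices are listed in the enumeration order of [A]; by [volumeE] below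
   the order is irrelevant. Only meaningful for nonempty [A]. *)
Definition volume A : R :=
  simplex_volume (fun i : 'I_(#|` A|.-1).+1 => nth 0 A i).

Definition strongly_rainbow (a : nat) X : Prop :=
  (forall A, [set` A] `<=` X -> #|` A| = a -> volume A <> 0) /\
  (forall A B, [set` A] `<=` X -> [set` B] `<=` X ->
     #|` A| = a -> #|` B| = a -> A <> B -> volume A <> volume B).

Definition strictly_rainbow (a : nat) X : Prop :=
  (forall a' : nat, (2 <= a' <= a)%N -> strongly_rainbow a' X) /\
  (exists (p : 'rV[R]_d) (V : {vspace 'rV[R]_d}),
     \dim V = (a - 1)%N /\ forall x, X x -> x - p \in V).

Lemma det_gram_edge k (p : 'I_k.+1 -> 'rV[R]_d)
    (P := \matrix_i p i : 'M[R]_(k.+1, d)) :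
  \det (edge_mx p *m (edge_mx p)^T) =
  \det (const_mx 1 + P *m P^T) - \det (P *m P^T).
Proof.
pose L : 'M[R]_(1 + k) := block_mx 1%:M 0 (const_mx (-1)) 1%:M.
have detL : \det L = 1 by rewrite /L det_lblock !det1 mulr1.
pose p0 : 'M[R]_(1, d) := p ord0; pose E := edge_mx p.
have LP : L *m (P : 'M_(1 + k, d)) = col_mx p0 E.
  rewrite -[P in LHS](@vsubmxK _ 1 k) mul_block_col mul1mx mul0mx addr0 mul1mx.
  have -> : @usubmx _ 1 k d P = p0.
    by apply/rowP => j; rewrite !mxE; congr (p _ _ _); apply: val_inj.
  congr col_mx; apply/matrixP => i j; rewrite !mxE big_ord1 !mxE mulN1r addrC.
  by congr (p _ _ _ - _); apply: val_inj.
have LJ : L *m (const_mx 1 : 'M_(1 + k)) *m L^T = block_mx 1%:M 0 0 0.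
  have -> : (const_mx 1 : 'M[R]_(1 + k)) =
      (const_mx 1 : 'M_(1 + k, 1)) *m (const_mx 1 : 'M_(1 + k, 1))^T.
    by apply/matrixP => i j; rewrite !mxE big_ord1 !mxE mulr1.
  rewrite mulmxA -mulmxA -trmx_mul.
  have -> : L *m (const_mx 1 : 'M_(1 + k, 1)) = col_mx 1%:M 0.
    rewrite -[const_mx 1](@vsubmxK _ 1 k) mul_block_col mul1mx mul0mx addr0.
    rewrite mul1mx; congr col_mx; apply/matrixP => i j; rewrite !mxE ?big_ord1.
      by rewrite (ord1 i) (ord1 j).
    by rewrite !mxE mulN1r addNr.
  by rewrite tr_col_mx mul_col_row !trmx0 trmx1 !mul0mx ?mulmx0 ?mulmx1.
have detLM (M : 'M[R]_(1 + k)) : \det (L *m M *m L^T) = \det M.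
  by rewrite !det_mulmx det_tr detL mul1r mulr1.
rewrite -[\det (const_mx 1 + _)]detLM -[\det (P *m P^T)]detLM.
rewrite mulmxDr mulmxDl LJ.
have -> : L *m (P *m P^T) *m L^T = col_mx p0 E *m (col_mx p0 E)^T.
  by rewrite -LP trmx_mul !mulmxA.
rewrite tr_col_mx mul_col_row add_block_mx !add0r -/E.
set a := p0 *m p0^T; set b := p0 *m E^T; set c := E *m p0^T; set G := E *m E^T.
pose B (x : 'M[R]_1) : 'M[R]_(1 + k) := block_mx x b c G.
rewrite -/(B _) -/(B _); apply/eqP; rewrite eq_sym subr_eq; apply/eqP.
pose C : 'M[R]_(1 + k) := block_mx 1%:M 0 c G.
have <- : \det C = \det G by rewrite /C det_lblock det1 mul1r.
rewrite (@determinant_multilinear _ _ (B (1%:M + a)) C (B a) ord0 1 1)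
  ?mul1r //.
- rewrite !scale1r; apply/rowP => j; rewrite !mxE.
  by case: splitP => // i _; rewrite !mxE; case: splitP => j' _; rewrite !mxE ?add0r.
- apply/matrixP => i j; rewrite !mxE; case: splitP => [i' /=|i' _].
    by rewrite (ord1 i').
  by rewrite !mxE.
- apply/matrixP => i j; rewrite !mxE; case: splitP => [i' /=|i' _].
    by rewrite (ord1 i').
  by rewrite !mxE.
Qed.

Lemma simplex_volume_perm k (p : 'I_k.+1 -> 'rV[R]_d) (s : 'S_k.+1) :
  simplex_volume (p \o s) = simplex_volume p.
Proof.
rewrite /simplex_volume; congr (Num.sqrt _ / _); rewrite !det_gram_edge.
set P := \matrix_i p i; set Q := \matrix_i _.
have QP : Q = row_perm s P by apply/matrixP => i j; rewrite !mxE.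
have detp (M : 'M[R]_k.+1) : \det (row_perm s (col_perm s M)) = \det M.
  rewrite row_permE col_permE !det_mulmx !det_perm odd_permV mulrCA -signr_addb addbb.
  by rewrite mulr1.
have PP : Q *m Q^T = row_perm s (col_perm s (P *m P^T)).
  by apply/matrixP => i j; rewrite QP !mxE; apply: eq_bigr => l _; rewrite !mxE.
congr (_ - _); last by rewrite PP detp.
rewrite -[RHS]detp; congr (\det _).
by rewrite PP; apply/matrixP => i j; rewrite !mxE.
Qed.

Lemma volumeE k (p : 'I_k.+1 -> 'rV[R]_d) : injective p ->
  volume [fset p i | i : 'I_k.+1]%fset = simplex_volume p.
Proof.
move=> p_inj; set A := (X in volume X).
have cA : #|` A| = k.+1 by rewrite card_imfset //= size_enum_ord.
have pA i : p i \in A by apply/imfsetP; exists i.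
have ltA i : (index (p i) A < k.+1)%N by rewrite -cA index_mem.
pose s i := Ordinal (ltA i).
have s_inj : injective s.
  move=> i j /(congr1 (fun o : 'I_k.+1 => nth 0 A o)) /=.
  by rewrite !nth_index //; exact: p_inj.
rewrite /volume; move: (_.-1) (congr1 predn cA) => n /= -> {n}.
rewrite -(simplex_volume_perm _ (perm s_inj)).
congr simplex_volume; apply/funext => i /=.
by rewrite permE /= nth_index.
Qed.

End Volume.

(* Main.v *)
Require Import Defs.
From mathcomp Require Import all_boot all_order all_algebra all_fingroup finmap.
From mathcomp Require Import all_classical wochoice reals.

Set Implicit Arguments.
Unset Strict Implicit.
Unset Printing Implicit Defensive.

Import Order.TTheory GRing.Theory Num.Theory.

Local Open Scope classical_set_scope.
Local Open Scope card_scope.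
Local Open Scope ring_scope.

(** Fewer than [K] conditions, each failing on fewer than [K] points, can be
    avoided simultaneously, because [K] is regular. So it suffices to find a
    part [X'] of [X] of full size on which each relation that a rainbow set
    must avoid either holds at fewer than [K] points of [X'] or at all of
    them, and to exclude the second case.

    Such an [X'] exists because the relations at stake live in a
    finite-dimensional space: for fixed [A], the squared volume of [x |` A] is
    a polynomial of degree at most 2 in [x], namely a positive multiple of the
    squared distance of [x] to the affine span of [A] ([volume_fsetU1]).
    Among the spaces of quadratic polynomials whose common zeros contain [K]
    many points of [X], take one of maximal dimension and let [X'] be the set
    of these zeros. A further polynomial that vanished at [K] many points of
    [X'] could be added to the space, so by maximality it vanishes on the
    whole of [X'] ([linear_family_dichotomy]).

    Let [m] be the dimension of the affine span of [X']. Take [Y] in [X'] that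
    is strongly rainbow for all sizes up to [m.+1], and [A], [B] in [Y] with
    [A] of size at most [m]. None of the three relations on [x] holds
    throughout [X'] ([small_colliding]):
    - [volume (x |` A) = 0] would put [X'] in the affine span of [A], which
      has dimension less than [m];
    - [volume (x |` A) = volume B] fails when [x] is a point of [A], where the
      polynomial of [A] is zero while [volume B] is not;
    - [volume (x |` A) = volume (x |` B)] fails when [x] is a point of [B]
      outside [A], where the polynomial of [B] is zero while the left side is
      the volume of a subset of [Y].
    Hence if [Y] had fewer than [K] points, all these relations together would
    fail to cover [X'] and [Y] could be enlarged by one more point. A maximal
    [Y], which exists by Zorn's lemma, therefore has [K] many points, and the
    theorem holds with [a := m.+1]. *)

(** * Sets of fewer points than a regular cardinal *)

(** By comparability of cardinals, this says that [A] has fewer elements than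
    [K]. *)
Definition small (K T : Type) (A : set T) : Prop := ~ ([set: K] #<= A).

Lemma sub_small K T (A B : set T) : A `<=` B -> small K B -> small K A.
Proof.
by move=> AB sB KA; apply: sB; apply: card_le_trans KA (subset_card_le AB).
Qed.

Lemma card_setT_le (K T : Type) (A : set T) : [set: K] #<= A ->
  exists2 h : K -> T, injective h & forall x, A (h x).
Proof.
move=> /card_leP[f].
exists (fun x => val (f (SigSub (in_setT x)))) => [x y /val_inj|x].
  by move=> /(inj (in_setT _) (in_setT _)) /(congr1 val).
exact/set_mem/valP.
Qed.

Lemma finite_small K T (A : set T) :
  infinite_set [set: K] -> finite_set A -> small K A.
Proof. by move=> Kinf Afin KA; apply: Kinf; apply: card_le_finite KA Afin. Qed.

Lemma well_order_total K (le : rel K) : well_order le -> total le.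
Proof.
move=> /(_ [pred z | `[< z = _ \/ z = _ >]]) wo x y.
have [|z [[/asboolP zP lez] _]] := wo x y.
  by exists x; apply/asboolP; left.
have lex : le z x by apply: lez; apply/asboolP; left.
have ley : le z y by apply: lez; apply/asboolP; right.
by apply/orP; case: zP => <-; [left|right].
Qed.

(** Small subsets of [K] are bounded, by regularity. If [K] were covered by a
    small family of small sets, the bounds of these sets would themselves be
    bounded, by a point that lies in none of the sets. *)
Lemma small_bigcup K I T (S : set I) (F : I -> set T) :
  regular_cardinal K -> small K S -> (forall i, S i -> small K (F i)) ->
  small K (\bigcup_(i in S) F i).
Proof.
move=> [Kinf [le [[wo _] reg]]] Ssmall Fsmall /card_setT_le[h hinj hF].
have total_le := well_order_total wo.
have bounded (B : set K) : small K B -> exists x, forall y, B y -> ~~ le x y.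
  move=> Bsmall; apply: contrapT => nob; apply/Bsmall/reg => x.
  apply: contrapT => nxB; apply: nob; exists x => y By; apply/negP => xy.
  by apply: nxB; exists y.
have [x0 _] := infinite_setN0 Kinf.
have /choice[b bP] i : exists x, S i -> forall y, F i (h y) -> ~~ le x y.
  have [Si|nSi] := pselect (S i); last by exists x0.
  have [|x xP] := bounded (h @^-1` F i); last by exists x.
  move=> KF; apply: (Fsmall i Si); apply: card_le_trans KF _.
  by apply: card_ge_preimage => ? ? _ _; apply: hinj.
have [|x xP] := bounded (b @` S).
  by move=> KbS; apply: Ssmall; apply: card_le_trans KbS (card_image_le _ _).
have [i Si Fix] := hF x.
have := total_le x (b i); rewrite (negPf (bP i Si x Fix)) orbF.
by rewrite (negPf (xP _ _)) //; exists i.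
Qed.

Lemma small_setU K T (A B : set T) :
  regular_cardinal K -> small K A -> small K B -> small K (A `|` B).
Proof.
move=> reg sA sB.
apply: sub_small (small_bigcup (S := [set: bool])
  (F := fun b : bool => if b then A else B) reg _ _).
- by move=> x [Ax|Bx]; [exists true|exists false].
- by apply: finite_small; [case: reg|exact: finite_finset].
- by case.
Qed.

(** The finite subsets of bounded size are handled one element at a time, by
    iterating [small_bigcup]; this avoids the cardinal arithmetic needed to
    count them. *)
Lemma small_bigcup_fset K (T : choiceType) U (S : set T) (n : nat)
    (F : {fset T} -> set U) :
  regular_cardinal K -> small K S ->
  (forall A : {fset T}, [set` A] `<=` S -> (#|` A| <= n)%N -> small K (F A)) ->
  small K (\bigcup_(A in [set A : {fset T} |
    [set` A] `<=` S /\ (#|` A| <= n)%N]) F A).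
Proof.
move=> reg sS; elim: n => [|n IHn] in F *; move=> sF.
  apply: (sub_small _ (sF fset0 _ _)); rewrite ?cardfs0 //.
    by move=> x [A [_]]; rewrite leqn0 cardfs_eq0 => /eqP ->.
have sF0 : small K (F fset0) by apply: sF; rewrite ?cardfs0.
have sFS y : S y -> small K (\bigcup_(A in [set A : {fset T} |
    [set` A] `<=` S /\ (#|` A| <= n)%N]) F (y |` A)%fset).
  move=> Sy; apply: IHn => A AS An; apply: sF.
    by move=> x /=; rewrite !inE => /orP[/eqP ->|/AS].
  rewrite cardfsU1; apply: leq_trans (leq_add (leq_b1 _) An) _.
  by rewrite add1n.
apply: (sub_small _ (small_setU reg sF0 (small_bigcup reg sS sFS))).
move=> u [A [AS An] Au]; have [A0|[y yA]] := fset_0Vmem A.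
  by left; rewrite -A0.
right; exists y; first exact: AS.
exists (A `\ y)%fset; last by rewrite fsetD1K.
split; first by move=> x /=; rewrite !inE => /andP[_ /AS].
by move: An; rewrite (cardfsD1 y) yA.
Qed.

(** * A Noetherian choice in a finite-dimensional space of functions *)

(** The set [X'] consists of the common zeros in [X] of a subspace of [W],
    of the largest possible dimension for which these zeros are not small. *)
Lemma linear_family_dichotomy K (F : fieldType) (W : vectType F) T
    (X : set T) (e : T -> W -> F) :
  (forall x a v w, e x (a *: v + w) = a * e x v + e x w) -> ~ small K X ->
  exists X' : set T, [/\ X' `<=` X, ~ small K X' &
    forall w, (forall x, X' x -> e x w = 0) \/
              small K [set x | X' x /\ e x w = 0]].
Proof.
move=> elin Xbig.
pose Z (I : {vspace W}) := [set x | X x /\ forall w, w \in I -> e x w = 0].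
pose P n := `[< exists2 I : {vspace W}, \dim I = n & ~ small K (Z I) >].
have e0 x : e x 0 = 0.
  have := elin x 1 0 0; rewrite scale1r addr0 mul1r => /esym/eqP.
  by rewrite -subr_eq0 addrK => /eqP.
have exP : exists n, P n.
  exists 0%N; apply/asboolP; exists 0%VS; first exact: dimv0.
  suff -> : Z 0%VS = X by [].
  apply/seteqP; split=> [x []//|x Xx]; split=> // w.
  by rewrite memv0 => /eqP ->; exact: e0.
have ubP n : P n -> (n <= \dim {: W})%N.
  by move=> /asboolP[I <- _]; apply/dimvS/subvf.
case: (ex_maxnP exP ubP) => n /asboolP[I dimI Ibig] maxI.
exists (Z I); split=> // [x []//|w].
have [wI|wNI] := boolP (w \in I); first by left=> x [_]; exact.
right; apply: contrapT => /contrapT sbig.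
have : P (\dim (I + <[w]>)).
  apply/asboolP; exists (I + <[w]>)%VS => //.
  suff -> : Z (I + <[w]>)%VS = [set x | Z I x /\ e x w = 0] by [].
  apply/seteqP; split=> x.
    move=> [Xx xI]; split; first split=> // v vI.
      by apply: xI; apply: subvP vI; exact: addvSl.
    by apply: xI; apply: subvP (memv_line w); exact: addvSr.
  move=> [[Xx xI] xw]; split=> // _ /memv_addP[v vI [_ /vlineP[a ->] ->]].
  by rewrite addrC elin xw mulr0 add0r xI.
move/maxI; rewrite leqNgt -dimI => /negP; apply.
rewrite ltnNge; apply/negP => le_dim; move/negP: wNI; apply.
have /eqP -> : (I == I + <[w]>)%VS by rewrite eqEdim addvSl.
by apply: subvP (memv_line w); exact: addvSr.
Qed.

(** * Quadratic polynomials and Gram determinants *)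

Section Quad.
Context {R : realType} {d : nat}.
Implicit Types (x p : 'rV[R]_d) (M N : 'M[R]_(1 + d)).

(** The polynomials of degree at most 2 in [x] are the quadratic forms in
    [(1, x)]; taking them in this homogeneous form makes them a matrix
    space. *)
Definition quad x M : R :=
  (row_mx 1%:M x *m M *m (row_mx 1%:M x)^T) ord0 ord0.

Lemma quad_linear x a M N : quad x (a *: M + N) = a * quad x M + quad x N.
Proof. by rewrite /quad mulmxDr -scalemxAr mulmxDl -scalemxAl !mxE. Qed.

Lemma quadZ x a M : quad x (a *: M) = a * quad x M.
Proof. by rewrite /quad -scalemxAr -scalemxAl mxE. Qed.

Lemma quad_const x c : quad x (block_mx c%:M 0 0 0) = c.
Proof.
rewrite /quad mul_row_block !mulmx0 mul1mx !addr0 tr_row_mx mul_row_col.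
by rewrite mul0mx addr0 trmx1 mulmx1 mxE mulr1n.
Qed.

Definition sqnorm n (v : 'rV[R]_n) : R := (v *m v^T) ord0 ord0.

Lemma sqnormE n (v : 'rV[R]_n) : sqnorm v = \sum_i v ord0 i ^+ 2.
Proof. by rewrite /sqnorm mxE; apply: eq_bigr => i _; rewrite mxE expr2. Qed.

Lemma sqnorm_ge0 n (v : 'rV[R]_n) : 0 <= sqnorm v.
Proof. by rewrite sqnormE sumr_ge0 // => i _; exact: sqr_ge0. Qed.

Lemma sqnorm_eq0 n (v : 'rV[R]_n) : sqnorm v = 0 -> v = 0.
Proof.
rewrite sqnormE => /eqP.
rewrite psumr_eq0 => [/allP v0|i _]; last exact: sqr_ge0.
apply/rowP => i; rewrite mxE; apply/eqP.
by have := v0 i (mem_index_enum i); rewrite sqrf_eq0.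
Qed.

(** The map [x |-> x - p] is linear in [(1, x)]. *)
Lemma quad_sqnorm (p : 'rV[R]_d) (W : 'M[R]_d) :
  exists M, forall x, quad x M = sqnorm ((x - p) *m W).
Proof.
pose T : 'M[R]_(1 + d, d) := col_mx (- p) 1%:M.
exists (T *m W *m (T *m W)^T) => x.
suff -> : (x - p) *m W = row_mx 1%:M x *m (T *m W).
  by rewrite /sqnorm /quad (trmx_mul (row_mx _ _)) !mulmxA.
by rewrite mulmxA mul_row_col mul1mx mulmx1 addrC.
Qed.

(** Gram determinants grow by the squared height: [u *m W] is the component
    of [u] orthogonal to the rows of [E], and replacing [u] by it is a row
    operation of determinant 1, after which the Gram matrix is block
    triangular. *)
Lemma det_gram_col_mx k (E : 'M[R]_(k, d)) (u : 'rV[R]_d)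
    (W := 1%:M - E^T *m invmx (E *m E^T) *m E) :
  E *m E^T \in unitmx ->
  \det (col_mx u E *m (col_mx u E)^T) = \det (E *m E^T) * sqnorm (u *m W).
Proof.
move=> Gunit; set G := E *m E^T; set w := u *m W.
have wE : w *m E^T = 0.
  rewrite /w -mulmxA mulmxBl mul1mx -!mulmxA mulVmx // mulmx1.
  by rewrite subrr mulmx0.
pose L : 'M[R]_(1 + k) := block_mx 1%:M (u *m E^T *m invmx G) 0 1%:M.
have -> : col_mx u E = L *m col_mx w E.
  rewrite /L mul_block_col !mul1mx mul0mx add0r; congr col_mx.
  by rewrite /w /W mulmxBr mulmx1 !mulmxA subrK.
rewrite trmx_mul mulmxA -(mulmxA L) !det_mulmx det_tr.
have -> : \det L = 1 by rewrite /L det_ublock !det1 mulr1.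
rewrite mul1r mulr1 tr_col_mx mul_col_row wE det_lblock mulrC.
by rewrite [w *m _]mx11_scalar det_scalar1.
Qed.
End Quad.

(** * The volume as a function of one vertex *)

Section Vol.
Context {R : realType} {d : nat}.
Implicit Types (x p : 'rV[R]_d) (A B : {fset 'rV[R]_d}) (s : seq 'rV[R]_d).

Definition seq_vertices p s (i : 'I_(size s).+1) := nth 0 (p :: s) i.

Lemma volume_seq p s : uniq (p :: s) ->
  volume [fset y in p :: s]%fset = simplex_volume (@seq_vertices p s).
Proof.
move=> us; rewrite -volumeE; last first.
  move=> i j /eqP; rewrite /seq_vertices (nth_uniq 0 _ _ us) ?ltn_ord //.
  by move/eqP/val_inj.
congr volume; apply/fsetP => y; rewrite in_fset /=.
apply/idP/imfsetP => [/(nthP (s := p :: s) 0)[i ip <-]|[i _ ->]].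
  by exists (Ordinal ip).
by apply: mem_nth; exact: ltn_ord.
Qed.

Lemma fset_seq A : (#|` A| > 0)%N ->
  exists p s,
    [/\ A = [fset y in p :: s]%fset, uniq (p :: s) & size s = #|` A|.-1].
Proof.
case: A => [[|p s] /= sP] //; rewrite /= => _.
have us := canonical_uniq sP.
exists p, s; split=> //; by apply/fsetP => y; rewrite in_fset.
Qed.

(** Up to a factorial, the volume of [x |` A] is that of [A] times the
    distance of [x] to the affine span of [A]; in the last clause this span
    is the translate of [V] by [p]. *)
Lemma volume_fsetU1 A : (#|` A| > 0)%N -> volume A <> 0 ->
  exists M : 'M[R]_(1 + d),
  [/\ forall x, x \notin A ->
        volume (x |` A)%fset = Num.sqrt (quad x M) / (#|` A|)`!%:R,
      forall x, 0 <= quad x M,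
      forall x, x \in A -> quad x M = 0 &
      exists p (V : {vspace 'rV[R]_d}), (\dim V < #|` A|)%N /\
        forall x, quad x M = 0 -> x - p \in V].
Proof.
move=> A0 volA; have [p [s [defA us sizes]]] := fset_seq A0.
have cardA : #|` A| = (size s).+1 by rewrite sizes prednK.
move: volA; rewrite cardA defA volume_seq //.
pose E := edge_mx (@seq_vertices p s); rewrite /simplex_volume -/E => volA.
have detG : 0 < \det (E *m E^T).
  rewrite ltNge; apply/negP; rewrite -sqrtr_eq0 => /eqP detG0.
  by apply: volA; rewrite detG0 mul0r.
have Gunit : E *m E^T \in unitmx by rewrite unitmxE unitfE gt_eqF.
pose W := 1%:M - E^T *m invmx (E *m E^T) *m E.
have [M0 quadM0] := quad_sqnorm p W.
pose M := \det (E *m E^T) *: M0.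
have quadM x : quad x M = \det (E *m E^T) * sqnorm ((x - p) *m W).
  by rewrite quadZ quadM0.
exists M; split.
- move=> x; rewrite in_fset /= => xA.
  (* The new vertex comes right after the base point [p], so that its edge is
     the first row of the new edge matrix. *)
  have -> : (x |` [fset y in p :: s])%fset = [fset y in p :: x :: s]%fset.
    by apply/fsetP => y; rewrite !inE orbCA.
  rewrite volume_seq; last first.
    move: xA us; rewrite /= !inE !negb_or eq_sym => /andP[-> ->] /=.
    by move=> /andP[-> ->].
  rewrite /simplex_volume quadM -det_gram_col_mx //.
  suff -> : edge_mx (seq_vertices p (s := x :: s)) = col_mx (x - p) E by [].
  apply/matrixP => i j; rewrite !mxE.
  case: splitP => i' ii'; rewrite !mxE /seq_vertices lift0 /= ii' //.
  by rewrite (ord1 i').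
- by move=> x; rewrite quadM mulr_ge0 ?sqnorm_ge0 // ltW.
- move=> x; rewrite in_fset /= => /(nthP (s := p :: s) 0)[i ip <-].
  rewrite quadM.
  suff -> : (nth 0 (p :: s) i - p) *m W = 0 by rewrite /sqnorm mul0mx mxE mulr0.
  case: i ip => [|i] ip; first by rewrite subrr mul0mx.
  have -> : nth 0 (p :: s) i.+1 - p = row (Ordinal (ip : (i < size s)%N)) E.
    by apply/rowP => j; rewrite !mxE.
  rewrite -row_mul /W mulmxBr mulmx1 !mulmxA mulmxV // mul1mx subrr.
  by apply/rowP => j; rewrite !mxE.
- pose rows := [seq row i E | i <- enum 'I_(size s)].
  exists p, <<rows>>%VS; split.
    by apply: leq_ltn_trans (dim_span _) _; rewrite size_map size_enum_ord.
  move=> x /eqP; rewrite quadM mulf_eq0 gt_eqF //= => /eqP /sqnorm_eq0.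
  rewrite /W mulmxBr mulmx1 mulmxA => /subr0_eq ->.
  rewrite mulmx_sum_row; apply: memv_suml => i _; apply/memvZ/memv_span.
  by apply: map_f; rewrite mem_enum.
Qed.

Lemma volume_fset1 A : #|` A| = 1%N -> volume A = 1.
Proof.
by move=> A1; rewrite /volume /simplex_volume A1 /= det_mx00 sqrtr1 fact0 divr1.
Qed.
End Vol.

(** * Extending rainbow sets *)

Lemma fset_sub_chain (T : choiceType) (F : set (set T)) (A : {fset T}) :
  total_on F subset -> A != fset0 -> [set` A] `<=` \bigcup_(X in F) X ->
  exists2 X, F X & [set` A] `<=` X.
Proof.
move=> totF; have [n] := ubnP #|` A|; elim: n A => // n IHn A An A0 AF.
have [/eqP|[y yA]] := fset_0Vmem A; first by rewrite (negPf A0).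
have [Z FZ Zy] := AF y yA.
have [AyE|Ay0] := eqVneq (A `\ y)%fset fset0.
  by exists Z => // z; rewrite -(fsetD1K yA) AyE /= !inE orbF => /eqP ->.
have [||X FX AX] := IHn (A `\ y)%fset _ Ay0.
- by move: An; rewrite (cardfsD1 y) yA.
- by move=> z /=; rewrite !inE => /andP[_ /AF].
have [ZX|XZ] := totF Z X FZ FX.
  exists X => // z /= zA; have [->|zy] := eqVneq z y; first exact: ZX.
  by apply: AX; rewrite /= !inE zy.
exists Z => // z /= zA; have [->//|zy] := eqVneq z y.
by apply: XZ; apply: AX; rewrite /= !inE zy.
Qed.

Section Rainbow.
Context {R : realType} {d : nat}.
Implicit Types (x p : 'rV[R]_d) (A B : {fset 'rV[R]_d}) (X Y : set 'rV[R]_d).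

Definition rainbow_upto a Y :=
  forall a', (2 <= a' <= a)%N -> strongly_rainbow a' Y.

Definition in_flat X p (V : {vspace 'rV[R]_d}) := forall x, X x -> x - p \in V.

Lemma affine_hull X : exists p (V : {vspace 'rV[R]_d}), in_flat X p V /\
  forall p' V', in_flat X p' V' -> (\dim V <= \dim V')%N.
Proof.
pose P n :=
  `[< exists p (V : {vspace 'rV[R]_d}), in_flat X p V /\ \dim V = n >].
have exP : exists n, P n.
  exists (\dim {: 'rV[R]_d}); apply/asboolP; exists 0, fullv.
  by split=> // x _; exact: memvf.
case: (ex_minnP exP) => _ /asboolP[p [V [XV <-]]] minV.
exists p, V; split=> // p' V' XV'.
by apply: minV; apply/asboolP; exists p', V'.
Qed.

(** The points [x] of [X] that cannot join a rainbow set containing [A] and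
    [B]. An equality of volumes between a set with [x] and a set without it,
    or between two sets with [x], is stated in terms of the old points [A] and
    [B] only. *)
Definition colliding X A B := [set x | [/\ X x, (#|` A| > 0)%N, x \notin A &
  [\/ volume (x |` A)%fset = 0,
      #|` B| = #|` A|.+1 /\ volume (x |` A)%fset = volume B |
      [/\ #|` B| = #|` A|, A <> B, x \notin B &
          volume (x |` A)%fset = volume (x |` B)%fset]]]].

(** Each kind of collision is the vanishing of a quadratic polynomial of [x]
    that does not vanish at all points of [X]. *)
Lemma small_colliding K X Y m A B :
  regular_cardinal K ->
  (forall M, (forall x, X x -> quad x M = 0) \/
             small K [set x | X x /\ quad x M = 0]) ->
  (forall p V, in_flat X p V -> (m <= \dim V)%N) ->
  Y `<=` X -> rainbow_upto m.+1 Y ->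
  [set` A] `<=` Y -> (#|` A| <= m)%N -> [set` B] `<=` Y ->
  (#|` B| <= m.+1)%N -> small K (colliding X A B).
Proof.
move=> reg dich flatX YX rY AY Am BY Bm.
have Kinf : infinite_set [set: K] by case: reg.
have [A0|Apos] := posnP #|` A|.
  apply: sub_small (finite_small Kinf (finite_set0 _)) => x [_].
  by rewrite A0.
have volA C : [set` C] `<=` Y -> (0 < #|` C| <= m.+1)%N -> volume C <> 0.
  move=> CY /andP[]; rewrite leq_eqVlt => /orP[/eqP C1|C2] Cm.
    by rewrite volume_fset1 //; apply/eqP; exact: oner_neq0.
  by have [|+ _] := rY #|` C|; [rewrite C2|apply].
have fact_neq0 n : n`!%:R != 0 :> R by rewrite pnatr_eq0 -lt0n fact_gt0.
have volE n (q v : R) : 0 <= q -> v = Num.sqrt q / n`!%:R ->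
  q = (v * n`!%:R) ^+ 2.
  by move=> q0 ->; rewrite divfK // sqr_sqrtr.
have [|MA [volMA MA_ge0 MA_A [p [V [dimV flatV]]]]] :=
  volume_fsetU1 Apos (volA A AY _).
  by rewrite Apos ltnW.
have sqvol x : x \notin A ->
  quad x MA = (volume (x |` A)%fset * (#|` A|)`!%:R) ^+ 2.
  by move=> xA; apply: volE => //; exact: volMA.
(* [X] does not lie in the affine span of [A]. *)
have sZ1 : small K [set x | [/\ X x, x \notin A & volume (x |` A)%fset = 0]].
  have [XM|] := dich MA; last first.
    apply: sub_small => x [Xx xA vol0]; split=> //.
    by rewrite sqvol // vol0 mul0r expr0n.
  have := flatX p V (fun x Xx => flatV x (XM x Xx)).
  by rewrite leqNgt (leq_trans dimV Am).
have sZ2 : small K [set x | [/\ X x, x \notin A, #|` B| = #|` A|.+1 &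
    volume (x |` A)%fset = volume B]].
  have [cB|cB] := pselect (#|` B| = #|` A|.+1); last first.
    by apply: sub_small (finite_small Kinf (finite_set0 _)) => x [].
  pose c : R := (volume B * (#|` A|)`!%:R) ^+ 2.
  have quadN x : quad x (-1 *: block_mx c%:M 0 0 0 + MA) = quad x MA - c.
    by rewrite quad_linear quad_const mulN1r addrC.
  have [XM|] := dich (-1 *: block_mx c%:M 0 0 0 + MA); last first.
    apply: sub_small => x [Xx xA _ vB]; split=> //.
    by rewrite quadN sqvol // vB subrr.
  (* A vertex of [A] is a point where the polynomial is not zero. *)
  have [A0|[y yA]] := fset_0Vmem A; first by move: Apos; rewrite A0 cardfs0.
  have := XM y (YX _ (AY _ yA)); rewrite quadN MA_A // sub0r => /eqP.
  rewrite oppr_eq0 sqrf_eq0 mulf_eq0 (negPf (fact_neq0 _)) orbF => /eqP vB.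
  by case: (volA B BY _ vB); rewrite Bm cB.
have sZ3 : small K [set x | [/\ X x, x \notin A, x \notin B &
    [/\ #|` B| = #|` A|, A <> B &
    volume (x |` A)%fset = volume (x |` B)%fset]]].
  have [[cB AB]|nAB] := pselect (#|` B| = #|` A| /\ A <> B); last first.
    apply: sub_small (finite_small Kinf (finite_set0 _)) => x [_ _ _ [cB AB _]].
    by apply: nAB.
  have [||MB [volMB MB_ge0 MB_B _]] := @volume_fsetU1 _ _ B.
    by rewrite cB.
    by apply: volA; rewrite // cB Apos ltnW.
  have quadN x : quad x (-1 *: MB + MA) = quad x MA - quad x MB.
    by rewrite quad_linear mulN1r addrC.
  have [XM|] := dich (-1 *: MB + MA); last first.
    apply: sub_small => x [Xx xA xB [_ _ vol_eq]]; split=> //.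
    rewrite quadN sqvol // (volE _ _ _ (MB_ge0 _) (volMB _ xB)).
    by rewrite vol_eq cB subrr.
  (* At a vertex [z] of [B] outside [A], the polynomial of [B] vanishes, that
     of [A] does not since [z |` A] is in [Y]. *)
  have [BA|/fsubsetPn[z zB zA]] := boolP (B `<=` A)%fset.
    by case: AB; apply/esym/eqP; rewrite eqEfcard BA cB leqnn.
  have := XM z (YX _ (BY _ zB)).
  rewrite quadN (MB_B z zB) subr0 sqvol // => /eqP.
  rewrite sqrf_eq0 mulf_eq0 (negPf (fact_neq0 _)) orbF => /eqP vz.
  case: (volA (z |` A)%fset _ _ vz); last by rewrite cardfsU1 zA ltnS.
  by move=> x /=; rewrite !inE => /orP[/eqP ->|/AY //]; exact: BY.
apply: sub_small (small_setU reg sZ1 (small_setU reg sZ2 sZ3)).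
move=> x [Xx _ xA [v|[cB v]|[cB AB xB v]]]; first by left.
- by right; left.
- by right; right.
Qed.

Lemma rainbow_setU1 X Y m x : X x -> rainbow_upto m.+1 Y ->
  (forall A B, [set` A] `<=` Y -> (#|` A| <= m)%N -> [set` B] `<=` Y ->
    (#|` B| <= m.+1)%N -> ~ colliding X A B x) ->
  rainbow_upto m.+1 (x |` Y).
Proof.
move=> Xx rY ncol a' a'm; have /andP[a'2 a'le] := a'm.
have [volY injY] := rY a' a'm.
have sub A : [set` A] `<=` x |` Y -> x \notin A -> [set` A] `<=` Y.
  by move=> AY xA y yA; have [yx|//] := AY y yA; move: xA; rewrite -yx yA.
have subD A : [set` A] `<=` x |` Y -> [set` (A `\ x)%fset] `<=` Y.
  move=> AY y /=; rewrite !inE => /andP[yx /AY [yx'|//]].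
  by move: yx; rewrite yx' eqxx.
have cardD A : x \in A -> #|` A| = #|` (A `\ x)%fset|.+1.
  by move=> xA; rewrite [LHS](cardfsD1 x) xA.
split=> [A AY cA|A B AY BY cA cB AB].
  have [xA|xA] := boolP (x \in A); last by apply: volY => //; exact: sub.
  have cD := cardD A xA; rewrite -(fsetD1K xA) => vol0.
  apply: (ncol (A `\ x)%fset fset0); rewrite ?cardfs0 //.
  - exact: subD.
  - by rewrite -ltnS -cD cA.
  split; rewrite ?inE ?eqxx //; first by rewrite -ltnS -cD cA.
  by constructor 1.
have half A' B' : x \in A' -> x \notin B' -> [set` A'] `<=` x |` Y ->
    [set` B'] `<=` x |` Y -> #|` A'| = a' -> #|` B'| = a' ->
  volume A' <> volume B'.
  move=> xA xB A'Y B'Y cA' cB'; have cD := cardD A' xA.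
  rewrite -(fsetD1K xA) => vol_eq.
  apply: (ncol (A' `\ x)%fset B').
  - exact: subD.
  - by rewrite -ltnS -cD cA'.
  - exact: sub.
  - by rewrite cB'.
  split; rewrite ?inE ?eqxx //; first by rewrite -ltnS -cD cA'.
  by constructor 2; rewrite -cD cA'.
have [xA|xA] := boolP (x \in A); have [xB|xB] := boolP (x \in B); first last.
- by apply: injY => //; exact: sub.
- by move/esym; apply: half.
- exact: half.
have cDA := cardD A xA; have cDB := cardD B xB.
rewrite -(fsetD1K xA) -(fsetD1K xB) => vol_eq.
apply: (ncol (A `\ x)%fset (B `\ x)%fset).
- exact: subD.
- by rewrite -ltnS -cDA cA.
- exact: subD.
- by rewrite ltnW // -cDB cB.
split; rewrite ?inE ?eqxx //; first by rewrite -ltnS -cDA cA.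
constructor 3; split; rewrite ?inE ?eqxx //.
  by apply: succn_inj; rewrite -cDA -cDB cA.
by move=> ABx; apply: AB; rewrite -(fsetD1K xA) -(fsetD1K xB) ABx.
Qed.

Lemma rainbow_bigcup a (F : set (set 'rV[R]_d)) :
  total_on F subset -> (forall Y, F Y -> rainbow_upto a Y) ->
  rainbow_upto a (\bigcup_(Y in F) Y).
Proof.
move=> totF rF a' a'a.
have a'pos : (0 < a')%N by case/andP: a'a => /ltnW.
split=> [A AF cA|A B AF BF cA cB].
  have [|Y FY AY] := fset_sub_chain totF _ AF.
    by rewrite -cardfs_gt0 cA.
  by have [+ _] := rF Y FY a' a'a; apply.
have [||Y FY ABY] := @fset_sub_chain _ _ (A `|` B)%fset totF.
- rewrite -cardfs_gt0.
  by apply: leq_trans (fsubset_leq_card (fsubsetUl A B)); rewrite cA.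
- by move=> x /=; rewrite inE => /orP[/AF|/BF].
have [_] := rF Y FY a' a'a; apply=> // x xAB; apply: ABY; rewrite /= inE.
  by apply/orP; left.
by apply/orP; right.
Qed.
End Rainbow.

Theorem theorem3p3 (R : realType) (d : nat) (hd : (1 <= d)%N)
    (K : Type) (hreg : regular_cardinal K) (hcont : [set: K] #<= [set: set nat])
    (X : set 'rV[R]_d) (hX : X #= [set: K]) :
  exists (Y : set 'rV[R]_d) (a : nat),
    [/\ Y `<=` X, Y #= [set: K], (2 <= a <= d.+1)%N & strictly_rainbow a Y].
Proof.
move: hX; rewrite card_eq_le => /andP[XK KX].
have Kinf : infinite_set [set: K] by case: hreg.
have [//|X' [X'X X'big dich]] :=
  linear_family_dichotomy (X := X) (@quad_linear R d) (K := K).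
have [p [V [X'V minV]]] := affine_hull X'.
pose P Y := Y `<=` X' /\ rainbow_upto (\dim V).+1 Y.
have [F FP totF|Y [[YX' rY] maxY]] := @Zorn_bigcup _ P.
  split; first by move=> x [Z /FP[ZX' _] /ZX'].
  by apply: rainbow_bigcup => // Z /FP[].
(* If [Y] were small, so would be the set of all points that collide with
   finite subsets of [Y], and a point of [X'] outside it would extend [Y]. *)
have Ybig : ~ small K Y.
  move=> sY.
  pose fsubs n :=
    [set A : {fset 'rV[R]_d} | [set` A] `<=` Y /\ (#|` A| <= n)%N].
  pose bad := \bigcup_(A in fsubs (\dim V))
    \bigcup_(B in fsubs (\dim V).+1) colliding X' A B.
  have sbad : small K (Y `|` bad).
    apply: small_setU => //; apply: small_bigcup_fset => // A AY Am.
    apply: small_bigcup_fset => // B BY Bm.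
    exact: (small_colliding hreg dich minV YX' rY).
  have [x [X'x nbad]] : exists x, X' x /\ ~ (Y `|` bad) x.
    apply: contrapT => nx; apply: X'big; apply: sub_small sbad => x X'x.
    by apply: contrapT => nbad; apply: nx; exists x.
  have nYx : ~ Y x by move=> Yx; apply: nbad; left.
  apply: (maxY (x |` Y)).
    by split=> [y Yy|/(_ x (or_introl erefl))//]; right.
  split; first by move=> y [->|/YX'].
  apply: rainbow_setU1 X'x rY _ => A B AY Am BY Bm col.
  by apply: nbad; right; exists A => //; exists B.
have YX : Y `<=` X by apply: subset_trans X'X.
exists Y, (\dim V).+1; split=> //.
- rewrite card_eq_le (card_le_trans (subset_card_le YX) XK).
  exact: contrapT.
- rewrite !ltnS; apply/andP; split.
    rewrite lt0n dimv_eq0; apply/eqP => V0; apply: X'big.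
    apply: finite_small Kinf _; apply: sub_finite_set (finite_set1 p) => x.
    by move=> /X'V; rewrite V0 memv0 subr_eq0 => /eqP.
  by have := dimvS (subvf V); rewrite dimvf dim_matrix mul1r.
- split=> //; exists p, V; split; first by rewrite subn1.
  by move=> x /YX' /X'V.
Qed.
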